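(* Let $r\ge0$ be an integer. For any graph $H$ and any weak $r$-shallow minor $G$ of $H$, $$\mathrm{ltw}(G)\leq(4r+1)\,\mathrm{ltw}(H).$$
   Context: Graphs are finite, simple and undirected. A layering of a graph $G$ is a partition $(V_0,V_1,\dots,V_q)$ of $V(G)$ such that for every edge $vw$, if $v\in V_i$ and $w\in V_j$ then $|i-j|\le1$. The layered width of a tree decomposition $(T,B)$ of $G$ is the minimum integer $\ell$ such that, for some layering $(V_0,\dots,V_q)$ of $G$, each bag $B(x)$ contains at most $\ell$ vertices of each layer $V_i$. The layered treewidth $\mathrm{ltw}(G)$ is the minimum layered width of a tree decomposition of $G$. A model of a graph $G$ in a graph $H$ is a function $\mu:V(G)\to2^{V(H)}$ such that: for each $v\in V(G)$, $\mu(v)$ is non-empty and $H[\mu(v)]$ is connected; $\mu(v)\cap\mu(w)=\emptyset$ for distinct $v,w\in V(G)$; and for every edge $vw\in E(G)$ there is an edge $ab\in E(H)$ with $a\in\mu(v)$ and $b\in\mu(w)$. The weak radius of a set $A\subseteq V(H)$ in $H$ is the minimum non-negative integer $r$ such that for some $v\in V(H)$ and every $a\in A$ we have $\mathrm{dist}_H(v,a)\le r$. A model $\mu$ of $G$ in $H$ is weak $r$-shallow if for each $v\in V(G)$, the weak radius of $\mu(v)$ in $H$ is at most $r$. $G$ is a weak $r$-shallow minor of $H$ if there exists a weak $r$-shallow model of $G$ in $H$. *)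

(* Defs.v *)
From mathcomp Require Import all_boot.
From mathcomp Require Import boolp.

Set Implicit Arguments.
Unset Strict Implicit.
Unset Printing Implicit Defensive.

Record sgraph := SGraph {
  vertex :> finType;
  edge : rel vertex;
  edge_sym : symmetric edge;
  edge_irrefl : irreflexive edge
}.

Arguments edge {s} x y.

Section Induced.
Variables (G : sgraph) (A : {set G}).

Definition induced_edge : rel {x : G | x \in A} :=
  [rel x y | edge (val x) (val y)].

Lemma induced_edge_sym : symmetric induced_edge.
Proof. by move=> x y; rewrite /induced_edge /= edge_sym. Qed.

Lemma induced_edge_irrefl : irreflexive induced_edge.
Proof. by move=> x; rewrite /induced_edge /= edge_irrefl. Qed.

Definition induced : sgraph := SGraph induced_edge_sym induced_edge_irrefl.

End Induced.

(* The graph without vertices is connected in this sense; nonemptiness is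
   required separately wherever it is needed. *)
Definition connected (G : sgraph) : Prop := forall x y : G, connect edge x y.

Definition acyclic (G : sgraph) : Prop :=
  forall c : seq G, 2 < size c -> ~~ ucycleb edge c.

Definition is_tree (T : sgraph) : Prop :=
  [/\ 0 < #|T|, connected T & acyclic T].

(* Minimum of a set of natural numbers; [None] stands for infinity, the
   minimum of the empty set. *)
Definition omin (P : nat -> Prop) : option nat :=
  if pselect (exists k, `[< P k >]) is left exP then Some (ex_minn exP)
  else None.

Definition oleq (d : option nat) (r : nat) : bool :=
  if d is Some k then k <= r else false.

Definition dist (G : sgraph) (v w : G) : option nat :=
  omin (fun k => exists p : seq G,
    [/\ path edge v p, last v p = w & size p = k]).

Definition weak_radius (G : sgraph) (A : {set G}) : option nat :=
  omin (fun r => exists v : G, forall a, a \in A -> oleq (dist v a) r).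

Definition is_model (G H : sgraph) (mu : G -> {set H}) : Prop :=
  [/\ forall v, mu v != set0 /\ connected (induced (mu v)),
      forall v w, v != w -> [disjoint mu v & mu w]
    & forall v w, edge v w ->
        exists a b, [/\ a \in mu v, b \in mu w & edge a b]].

Definition weak_shallow (r : nat) (G H : sgraph) (mu : G -> {set H}) : Prop :=
  forall v, oleq (weak_radius (mu v)) r.

Definition weak_shallow_minor (r : nat) (G H : sgraph) : Prop :=
  exists mu : G -> {set H}, is_model mu /\ weak_shallow r mu.

(* A layering (V_0, ..., V_q) is encoded by the map sending each vertex to the
   index of its layer; some layers may be empty. *)
Definition is_layering (G : sgraph) (L : G -> nat) : Prop :=
  forall v w, edge v w -> (L v <= (L w).+1) && (L w <= (L v).+1).

Definition tree_decomposition (G T : sgraph) (B : T -> {set G}) : Prop :=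
  [/\ is_tree T,
      forall v w : G, edge v w -> exists x, (v \in B x) && (w \in B x)
    & forall v : G, let X := [set x | v \in B x] in
        X != set0 /\ connected (induced X)].

Section LayeredWidth.
Variables (G T : sgraph) (B : T -> {set G}).

Definition layered_width_le (l : nat) : Prop :=
  exists2 L : G -> nat, is_layering L &
    forall x i, #|[set v in B x | L v == i]| <= l.

Lemma layered_width_ex : exists l, `[< layered_width_le l >].
Proof.
exists #|G|; apply/asboolP; exists (fun=> 0) => [v w _ //|x i].
exact: max_card.
Qed.

Definition layered_width : nat := ex_minn layered_width_ex.

End LayeredWidth.

Section LayeredTreewidth.
Variable G : sgraph.

Definition has_decomposition_of_layered_width (l : nat) : Prop :=
  exists (T : sgraph) (B : T -> {set G}),
    tree_decomposition B /\ layered_width B = l.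

Lemma decomposition_ex : exists l, `[< has_decomposition_of_layered_width l >].
Proof.
have e_sym : symmetric [rel x y : unit | false] by [].
have e_irr : irreflexive [rel x y : unit | false] by [].
pose T := SGraph e_sym e_irr; pose B (_ : T) := [set: G].
exists (layered_width B); apply/asboolP; exists T, B; split=> //; split.
- split; first by rewrite card_unit.
  + by move=> [] [].
  + by case=> [|[] [|[] c]] // _; rewrite /ucycleb /=.
- by move=> v w _; exists tt; rewrite !inE.
- move=> v X; split; first by apply/set0Pn; exists tt; rewrite !inE.
  move=> x y; suff -> : x = y by [].
  by apply: val_inj; case: (val x); case: (val y).
Qed.

Definition ltw : nat := ex_minn decomposition_ex.

End LayeredTreewidth.

(* Main.v *)
Require Import Defs.
From mathcomp Require Import all_boot.
From mathcomp Require Import boolp zify.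

Set Implicit Arguments.
Unset Strict Implicit.
Unset Printing Implicit Defensive.

(** Let [mu] be a weak [r]-shallow model of [G] in [H], let [B] be a tree
    decomposition of [H] over [T], and let [L] be a layering of [H] for which
    every bag has at most [l] vertices in each layer.

    Contracting the branch sets keeps the tree: the bag of [G] at [x] collects
    the vertices whose branch set meets [B x] ([model_bag]). The nodes seen by
    a vertex [v] are then the union of the subtrees of the vertices of [mu v],
    and this union is connected because [mu v] is, adjacent vertices of [H]
    having intersecting subtrees ([model_bag_decomposition]).

    Layers must be coarsened. Give [v] a centre [c v] within distance [r] of
    all of [mu v]. As [L] changes by at most 1 along an edge, the centres of
    adjacent vertices of [G] are at most [2r + 1] layers apart, so grouping the
    layers of [H] into blocks of [2r + 1] and placing [v] in the block of [c v]
    gives a layering of [G]. If [v] lies in a given block and in the bag at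
    [x], then [mu v] meets [B x] in a vertex at most [r] layers away from this
    block, hence in one of [(2r + 1) + 2r = 4r + 1] consecutive layers. These
    layers contain at most [(4r + 1) l] vertices of [B x], and disjointness of
    the branch sets bounds the number of such [v] by the number of those
    vertices. *)

(** Walks that stay in [A], without the subtype of vertices of [induced A], so
    that walks for different sets [A] can be compared and concatenated. *)
Definition inside (G : sgraph) (A : {set G}) : rel G :=
  [rel x y | [&& x \in A, y \in A & edge x y]].

Lemma connect_insideS (G : sgraph) (A A' : {set G}) (x y : G) :
  A \subset A' -> connect (inside A) x y -> connect (inside A') x y.
Proof.
move=> /subsetP sAA'; apply: connect_sub => u w /and3P[uA wA uw].
by apply: connect1; rewrite /inside /= !sAA'.
Qed.

Lemma connected_inducedP (G : sgraph) (A : {set G}) :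
  connected (induced A) <-> {in A &, forall x y, connect (inside A) x y}.
Proof.
split=> [conA x y xA yA | conA [x xA] [y yA]].
  have /connectP[p] := conA (exist _ x xA) (exist _ y yA).
  elim: p x xA => [|[z zA] p IHp] x xA /=; first by move=> _ [->].
  case/andP=> xz zp lastp; apply: connect_trans (IHp z zA zp lastp).
  by apply: connect1; rewrite /inside /= xA zA.
have /connectP[p] := conA x y xA yA.
elim: p x xA => [|z p IHp] x xA /=.
  by move=> _ eyx; rewrite (_ : exist _ x xA = exist _ y yA) //; apply: val_inj.
case/andP=> /and3P[_ zA xz] zp lastp.
by apply: connect_trans (IHp z zA zp lastp); apply: connect1.
Qed.

Lemma oleq_omin (P : nat -> Prop) (r : nat) :
  oleq (omin P) r -> exists2 k, P k & k <= r.
Proof.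
rewrite /omin; case: pselect => [exP|//] /=.
by case: ex_minnP => k /asboolP Pk _ lekr; exists k.
Qed.

Lemma layering_path (G : sgraph) (L : G -> nat) (v : G) (p : seq G) :
  is_layering L -> path edge v p ->
  (L v <= L (last v p) + size p) && (L (last v p) <= L v + size p).
Proof.
move=> layL; elim: p v => [|u p IHp] v /=; first by move=> _; lia.
by case/andP=> /layL vu /IHp; lia.
Qed.

Lemma layering_dist (G : sgraph) (L : G -> nat) (v w : G) (r : nat) :
  is_layering L -> oleq (dist v w) r -> (L v <= L w + r) && (L w <= L v + r).
Proof.
move=> layL /oleq_omin[k [p [vp <- <-]]].
by have := layering_path layL vp; lia.
Qed.

Lemma weak_radius_centre (G : sgraph) (A : {set G}) (r : nat) :
  oleq (weak_radius A) r ->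
  exists c : G, forall a, a \in A -> oleq (dist c a) r.
Proof.
case/oleq_omin=> k [c dist_c] lekr; exists c => a /dist_c.
by case: (dist c a) => //= d /leq_trans; apply.
Qed.

Lemma leq_div_layers (d m n : nat) :
  0 < d -> m <= n + d -> m %/ d <= (n %/ d).+1.
Proof.
move=> d_gt0 /(leq_div2r d); rewrite divnDr ?dvdnn // divnn d_gt0.
by rewrite addn1.
Qed.

Lemma card_consecutive_fibres (T : finType) (A : {set T}) (L : T -> nat)
    (l m n : nat) :
  (forall k, #|[set a in A | L a == k]| <= l) ->
  #|[set a in A | m <= L a < m + n]| <= n * l.
Proof.
move=> fibre_le; elim: n => [|n IHn].
  by rewrite eq_card0 // => a; rewrite !inE; lia.
rewrite mulSnr; apply: leq_trans (leq_add IHn (fibre_le (m + n))).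
apply: leq_trans (leq_card_setU _ _).
apply/subset_leq_card/subsetP => a; rewrite !inE; case: (a \in A) => //=; lia.
Qed.

(** Each element of [S] lies in at most one of the sets [mu v], so sending it
    to the index of that set covers all the indices counted on the left. *)
Lemma card_disjoint_transversal (I T : finType) (mu : I -> {set T})
    (V : {set I}) (S : {set T}) :
  (forall v w, v != w -> [disjoint mu v & mu w]) ->
  (forall v, v \in V -> exists2 a, a \in mu v & a \in S) ->
  #|V| <= #|S|.
Proof.
move=> disj_mu meetS; pose index a := [pick v | a \in mu v].
have Some_injective : injective (@Some I) by move=> v w [].
rewrite -(card_imset (mem V) Some_injective).
apply: leq_trans (leq_imset_card index S).
apply/subset_leq_card/subsetP => _ /imsetP[v /meetS[a av aS] ->].
apply/imsetP; exists a => //; rewrite /index; case: pickP => [w aw|/(_ v)].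
  congr Some; apply: contraTeq av => /disj_mu dvw.
  by rewrite (disjointFl dvw aw).
by rewrite av.
Qed.

Definition model_bag (G H T : sgraph) (mu : G -> {set H}) (B : T -> {set H})
    (x : T) : {set G} := [set v | mu v :&: B x != set0].

Lemma mem_model_bag (G H T : sgraph) (mu : G -> {set H}) (B : T -> {set H})
    (x : T) (v : G) (a : H) :
  a \in mu v -> a \in B x -> v \in model_bag mu B x.
Proof.
by move=> av aBx; rewrite inE; apply/set0Pn; exists a; rewrite inE av.
Qed.

Lemma model_bag_decomposition (G H T : sgraph) (mu : G -> {set H})
    (B : T -> {set H}) :
  is_model mu -> tree_decomposition B -> tree_decomposition (model_bag mu B).
Proof.
case=> mu_con _ mu_edge [treeT B_edge B_con]; split=> // [v w vw | v X].
  have [a [b [av bw ab]]] := mu_edge v w vw.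
  have [x /andP[aBx bBx]] := B_edge a b ab; exists x.
  by rewrite (mem_model_bag av aBx) (mem_model_bag bw bBx).
have [/set0Pn[a0 a0v] /connected_inducedP mu_v_con] := mu_con v.
have con1 a x y : a \in mu v -> a \in B x -> a \in B y ->
    connect (inside X) x y.
  move=> av aBx aBy; have [_ /connected_inducedP Xa_con] := B_con a.
  apply: (connect_insideS _ (Xa_con x y _ _)); rewrite ?inE //.
  apply/subsetP => z; rewrite inE => aBz.
  by rewrite inE (mem_model_bag av aBz).
split.
  have [/set0Pn[x]] := B_con a0; rewrite inE => a0Bx _.
  by apply/set0Pn; exists x; rewrite inE (mem_model_bag a0v a0Bx).
apply/connected_inducedP => x y; rewrite !inE.
case/set0Pn=> a /setIP[av aBx] /set0Pn[b /setIP[bv bBy]].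
have /connectP[p] := mu_v_con a b av bv.
(* Follow a walk from a to b inside mu v, changing subtree at each edge in a
   node whose bag contains both of its ends. *)
elim: p a x av aBx => [|c p IHp] a x av aBx /=.
  by move=> _ eba; apply: (con1 b); rewrite // eba.
case/andP=> /and3P[_ cv ac] cp lastp.
have [z /andP[aBz cBz]] := B_edge a c ac.
by apply: connect_trans (con1 a x z av aBx aBz) (IHp c z cv cBz cp lastp).
Qed.

Lemma model_bag_layered_width (r l : nat) (G H T : sgraph)
    (mu : G -> {set H}) (B : T -> {set H}) :
  is_model mu -> weak_shallow r mu -> layered_width_le B l ->
  layered_width_le (model_bag mu B) ((4 * r + 1) * l).
Proof.
case=> _ mu_disj mu_edge shallow [L layL width_le].
have [c cP] := choice (fun v => weak_radius_centre (shallow v)).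
have c_near v a : a \in mu v -> (L (c v) <= L a + r) && (L a <= L (c v) + r).
  by move=> /cP; apply: layering_dist.
pose d := 2 * r + 1; have d_gt0 : 0 < d by rewrite /d; lia.
exists (fun v => L (c v) %/ d) => [v w /mu_edge[a [b [av bw ab]]] | x i].
  have := c_near v a av; have := c_near w b bw; have := layL a b ab.
  by move=> hab hw hv; rewrite !leq_div_layers // /d; lia.
(* Adding r to the layers avoids a negative lower end for the first block. *)
pose S := [set a in B x | i * d <= L a + r < i * d + (4 * r + 1)].
have S_le : #|S| <= (4 * r + 1) * l.
  apply: card_consecutive_fibres => k; apply: leq_trans (width_le x (k - r)).
  apply/subset_leq_card/subsetP => a; rewrite !inE.
  by case: (a \in B x) => //=; lia.
apply: leq_trans S_le; apply: (card_disjoint_transversal mu_disj) => v.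
rewrite !inE => /andP[/set0Pn[a /setIP[av aBx]] /eqP eq_i].
exists a => //; rewrite inE aBx /=.
have := c_near v a av; have := divn_eq (L (c v)) d.
have := ltn_pmod (L (c v)) d_gt0; rewrite eq_i /d; lia.
Qed.

Lemma layered_widthP (G T : sgraph) (B : T -> {set G}) :
  layered_width_le B (layered_width B).
Proof. by rewrite /layered_width; case: ex_minnP => l /asboolP. Qed.

Lemma layered_width_min (G T : sgraph) (B : T -> {set G}) (l : nat) :
  layered_width_le B l -> layered_width B <= l.
Proof. by rewrite /layered_width; case: ex_minnP => k _ kP /asboolP/kP. Qed.

Lemma ltw_attained (G : sgraph) : has_decomposition_of_layered_width G (ltw G).
Proof. by rewrite /ltw; case: ex_minnP => l /asboolP. Qed.

Lemma ltw_min (G T : sgraph) (B : T -> {set G}) :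
  tree_decomposition B -> ltw G <= layered_width B.
Proof.
move=> decB; rewrite /ltw; case: ex_minnP => k _; apply.
by apply/asboolP; exists T, B.
Qed.

Theorem lemma6p1 (r : nat) (G H : sgraph) (hGH : weak_shallow_minor r G H) :
  ltw G <= (4 * r + 1) * ltw H.
Proof.
have [mu [mu_model mu_shallow]] := hGH.
have [T [B [decB <-]]] := ltw_attained H.
apply: leq_trans (ltw_min (model_bag_decomposition mu_model decB)) _.
apply: layered_width_min.
exact: model_bag_layered_width mu_model mu_shallow (layered_widthP B).
Qed.
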